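(* Let $G(V,E)$ be a connected planar trivalent graph, let $\Gamma$ be a plane graph for $G$, and let $\widehat{VCH}_2^{*}(\Gamma)$ be its associated filtered $2$-color vertex homology (over $\mathbb{C}$). Then the rank of the zeroth filtered $2$-color vertex homology group is twice the number of perfect matchings, i.e. $$\dim \widehat{VCH}_2^{0}(\Gamma) = 2\cdot \#\{\text{perfect matchings of }G\}.$$
   Context: Graphs are finite multigraphs: loops and multiple edges are allowed, and so are ''vertex-less'' edges (circles, also regarded as loops). Trivalent means every vertex has degree 3 (a loop at a vertex counts twice). A perfect matching is a set of non-loop edges such that each vertex is incident to exactly one of them. Ribbon graphs. A ribbon graph $\Gamma$ of $G$ is a surface with boundary in which $G$ is embedded and which deformation retracts onto $G$; combinatorially, a disc for each vertex and a band for each edge, with a cyclic order of half-edges at each vertex and possibly half-twisted bands (a vertex-less edge gives an annulus or Möbius band). Capping the boundary circles by discs gives a closed surface $\overline\Gamma$. A plane graph is an embedding of a connected planar graph into the sphere, i.e. a ribbon graph with $\overline\Gamma=S^2$. States. Let $H$ be the set of half-edges (pairs of an edge and one of its ends at a vertex). For $\alpha\in\{0,1\}^H$, $\Gamma_\alpha$ is obtained from $\Gamma$ by inserting, for each $h$ with $\alpha_h=1$, one half-twist in the band of the edge containing $h$. For $\nu\in\{0,1\}^V$ let $\alpha(\nu)_h=\nu_v$ where $v$ is the vertex of $h$, $\Gamma_\nu:=\Gamma_{\alpha(\nu)}$, $|\nu|=\sum_v\nu_v$. Circles of a state are its boundary circles. Filtered $n$-color vertex homology (here $n=2$). Let $m=n/2$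 if $n$ is even, $m=(n-1)/2$ if $n$ is odd, $\widehat A=\mathbb{C}[x]/(x^n-1)$, with $\widehat\mu$ the multiplication, $\widehat\Delta(x^k)=\sum_{0\le i,j<n,\ i+j\equiv k+2m\ (n)}x^i\otimes x^j$, $\widehat\eta(x^k)=\sqrt n\,x^{k+m}$. Put $\widehat A_\alpha=\widehat A^{\otimes(\text{circles of }\Gamma_\alpha)}$. If $\alpha'$ is obtained from $\alpha$ by changing one coordinate from 0 to 1, the half-twist merges two circles, splits one circle into two, or changes one circle to one circle; $\widehat\partial_{\alpha\alpha'}$ applies $\widehat\mu,\widehat\Delta,\widehat\eta$ respectively on affected factors and the identity elsewhere. If $\nu'$ is obtained from $\nu$ by changing one coordinate from 0 to 1, $\widehat\delta_{\nu\nu'}$ is the composition of three maps $\widehat\partial$ along any 3-step path from $\alpha(\nu)$ to $\alpha(\nu')$ (independent of the path). Ordering $V$, let $\widehat C_n^i(\Gamma)=\bigoplus_{|\nu|=i}\widehat A_{\alpha(\nu)}$ and $\widehat\delta=\sum_{\nu'}(-1)^s\widehat\delta_{\nu\nu'}$ on the $\nu$-summand, with $s$ the number of 1's of $\nu$ before the changed coordinate. $\widehat{VCH}_n^i(\Gamma)$ is the homology of $(\widehat C_n^*(\Gamma),\widehat\delta)$ at $i$.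
   Formalization: The graph is assumed to have at least one vertex; this excludes only the single vertex-less circle in the sphere, for which the claim as stated fails (the homology has dimension 4, while the empty set is the only perfect matching, giving 2). *)

(* Defs.v *)
From HB Require Import structures.
From mathcomp Require Import all_boot all_order all_fingroup all_algebra.
From mathcomp Require Export complex reals.

Set Implicit Arguments.
Unset Strict Implicit.
Unset Printing Implicit Defensive.

Import Order.TTheory GRing.Theory Num.Theory.

Local Open Scope ring_scope.

(* Ordinary edges have two ends, labelled by [bool]; the vertex-less edges     *)
(* (circles) form a separate type, so that the edges of the graph are          *)
(* [edge + circle_edge].                                                       *)
Record multigraph := Multigraph {
  vertex : finType;
  edge : finType;
  circle_edge : finType;
  endpoint : edge -> bool -> vertex }.

Section Graph.
Variable G : multigraph.

Definition half_edge : finType := (edge G * bool)%type.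

Definition vertex_of (h : half_edge) : vertex G := endpoint h.1 h.2.

Definition opposite (h : half_edge) : half_edge := (h.1, ~~ h.2).

Definition half_edges_at (v : vertex G) : {set half_edge} :=
  [set h | vertex_of h == v].

Definition trivalent := forall v : vertex G, #|half_edges_at v| = 3%N.

Definition is_loop (e : edge G) := endpoint e false == endpoint e true.

Definition incident (v : vertex G) (e : edge G) := [exists b, endpoint e b == v].

(* Vertex-less edges count as loops, so a matching only has ordinary edges. *)
Definition perfect_matching (M : {set edge G}) :=
  [forall e in M, ~~ is_loop e] &&
  [forall v, #|[set e in M | incident v e]| == 1%N].

(* The components of the underlying space are the classes of vertices joined   *)
(* by edges, and each circle on its own.                                       *)
Definition adjacent (x y : vertex G + circle_edge G) :=
  match x, y with
  | inl u, inl v => [exists e, incident u e && incident v e]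
  | _, _ => false
  end.

Definition connected_graph := n_comp adjacent predT = 1%N.

End Graph.

(* The cyclic order at v is the restriction of [rotation] to the half-edges at *)
(* v. [twist] and [circle_twist] give the parity of the number of half-twists  *)
(* of a band, relative to the orientations of the vertex discs.                *)
Record ribbon_graph (G : multigraph) := RibbonGraph {
  rotation : {perm half_edge G};
  rotationP : forall h h' : half_edge G,
    (h' \in porbit rotation h) = (vertex_of h' == vertex_of h);
  twist : edge G -> bool;
  circle_twist : circle_edge G -> bool }.

Section Ribbon.
Variables (G : multigraph) (Gamma : ribbon_graph G).

(* A flag is one of the two long sides of a band, seen from a half-edge h:     *)
(* (inl h, true) is the side next to [rotation h], (inl h, false) the side     *)
(* next to [rotation^-1 h]. The two sides of the band of a circle z are        *)
(* (inr z, true) and (inr z, false).                                           *)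
Definition flag : finType := ((half_edge G + circle_edge G) * bool)%type.

(* A state alpha in {0,1}^H is given as the set of half-edges h with           *)
(* alpha_h = 1.                                                                *)
Implicit Type alpha : {set half_edge G}.

Definition half_twisted alpha (e : edge G) : bool :=
  twist Gamma e (+) ((e, false) \in alpha) (+) ((e, true) \in alpha).

(* Following the boundary of the vertex disc from a band to the next one. *)
Definition corner (f : flag) : flag :=
  match f with
  | (inl h, true) => (inl (rotation Gamma h), false)
  | (inl h, false) => (inl ((rotation Gamma)^-1%g h), true)
  | (inr z, b) => (inr z, b)
  end.

(* Following the side of a band to its other end; an untwisted band matches    *)
(* the two cyclic orders with opposite orientations. The two sides of the band *)
(* of a circle are joined exactly when it is a Moebius band.                   *)
Definition side alpha (f : flag) : flag :=
  match f with
  | (inl h, b) => (inl (opposite h), b (+) ~~ half_twisted alpha h.1)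
  | (inr z, b) => (inr z, b (+) circle_twist Gamma z)
  end.

(* [corner] and [side alpha] are involutions, so this relation is symmetric. *)
Definition boundary_rel alpha : rel flag :=
  [rel f g | (g == corner f) || (g == side alpha f)].

Definition boundary_circle alpha (f : flag) : {set flag} :=
  [set g | connect (boundary_rel alpha) f g].

(* The boundary circles of Gamma_alpha, as sets of flags. A vertex of degree 0 *)
(* carries no flag, so this is the boundary of the surface only for graphs     *)
(* without isolated vertices.                                                  *)
Definition circle alpha : finType :=
  {c : {set flag} | c \in boundary_circle alpha @: [set: flag]}.

Definition circle_of alpha (f : flag) : circle alpha :=
  exist _ (boundary_circle alpha f) (imset_f (boundary_circle alpha) (in_setT f)).

(* Euler characteristic of the closed surface obtained by capping the boundary *)
(* circles of Gamma with discs; a circle has Euler characteristic 0.           *)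
Definition closed_euler_char : int :=
  #|vertex G|%:Z - #|edge G|%:Z + #|circle set0|%:Z.

(* The sphere is the connected closed surface of Euler characteristic 2. *)
Definition plane_graph := connected_graph G /\ closed_euler_char = 2.

End Ribbon.

(* The choices entering the chain complex: an ordering of the vertices, and,   *)
(* for each nu and v, a path from alpha(nu) to alpha(nu'), that is an order in *)
(* which the half-edges at v are twisted.                                      *)
Record conventions (G : multigraph) := Conventions {
  vertex_rank : vertex G -> nat;
  vertex_rank_inj : injective vertex_rank;
  step_order : {set vertex G} -> vertex G -> seq (half_edge G);
  step_orderP : forall nu v, perm_eq (step_order nu v) (enum (half_edges_at v)) }.

Fact enum_rank_nat_inj (T : finType) :
  injective (fun x : T => enum_rank x : nat).
Proof. by move=> u v /val_inj /enum_rank_inj. Qed.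

Definition default_conventions (G : multigraph) : conventions G :=
  Conventions (@enum_rank_nat_inj (vertex G))
    (fun _ v => perm_refl (enum (half_edges_at v))).

Section Complex.
Variables (C : numClosedFieldType) (G : multigraph) (Gamma : ribbon_graph G).
Variables (o : conventions G) (n : nat).
Implicit Type alpha : {set half_edge G}.
Implicit Type nu : {set vertex G}.

(* k stands for the element \bigotimes_c x^(k c) of the monomial basis of      *)
(* (C[x]/(x^n - 1))^{\otimes circles of Gamma_alpha}.                          *)
Definition monomial alpha : finType := {ffun circle Gamma alpha -> 'I_n}.

Definition Ahat alpha : vectType C := {ffun monomial alpha -> C^o}.

(* The integer m: n/2 for n even and (n-1)/2 for n odd. *)
Let m : nat := n./2.

(* [mu_coef i j k], [Delta_coef k i j] and [eta_coef k l] are the coefficients *)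
(* of x^k in mu(x^i (x) x^j), of x^i (x) x^j in Delta(x^k) and of x^l in       *)
(* eta(x^k).                                                                   *)
Definition mu_coef (i j k : 'I_n) : C := (i + j == k %[mod n])%N%:R.

Definition Delta_coef (k i j : 'I_n) : C :=
  (i + j == k + 2 * m %[mod n])%N%:R.

Definition eta_coef (k l : 'I_n) : C :=
  sqrtC n%:R * (l == k + m %[mod n])%N%:R.

(* Coefficient of k' in the image of k under the map for the half-twist at h,  *)
(* meaningful for alpha' = h |: alpha with h \notin alpha. The affected        *)
(* circles are those running along the band of h: a0, a1 before and b0, b1     *)
(* after the half-twist. The other circles are the same in both states.        *)
Definition partial_coef alpha alpha' (h : half_edge G)
    (k : monomial alpha) (k' : monomial alpha') : C :=
  let a0 := circle_of Gamma alpha (inl h, false) in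
  let a1 := circle_of Gamma alpha (inl h, true) in
  let b0 := circle_of Gamma alpha' (inl h, false) in
  let b1 := circle_of Gamma alpha' (inl h, true) in
  [forall f, (circle_of Gamma alpha f \notin [:: a0; a1]) ==>
     (k' (circle_of Gamma alpha' f) == k (circle_of Gamma alpha f))]%:R *
  (if a0 != a1 then mu_coef (k a0) (k a1) (k' b0)
   else if b0 != b1 then Delta_coef (k a0) (k' b0) (k' b1)
   else eta_coef (k a0) (k' b0)).

Definition partial_fun alpha alpha' h (u : Ahat alpha) : Ahat alpha' :=
  [ffun k' => \sum_k u k * partial_coef h k k'].

Fact partial_fun_linear alpha alpha' h : linear (@partial_fun alpha alpha' h).
Proof.
move=> a u v; apply/ffunP=> k'; rewrite !ffunE scaler_sumr -big_split /=.
by apply: eq_bigr => k _; rewrite !ffunE mulrDl -scalerAl.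
Qed.

HB.instance Definition _ alpha alpha' h :=
  GRing.isLinear.Build C (Ahat alpha) (Ahat alpha') *:%R
    (@partial_fun alpha alpha' h) (@partial_fun_linear alpha alpha' h).

Definition partial alpha alpha' h : 'Hom(Ahat alpha, Ahat alpha') :=
  linfun (@partial_fun alpha alpha' h).

(* Composition of the maps [partial] along the path from alpha that successively *)
(* changes the half-edges in s; alpha' is the end of this path. The value for  *)
(* the empty path is irrelevant.                                               *)
Fixpoint partial_path alpha (s : seq (half_edge G)) alpha' :
    'Hom(Ahat alpha, Ahat alpha') :=
  match s with
  | [::] => 0
  | [:: h] => partial alpha alpha' h
  | h :: s' =>
      (partial_path (h |: alpha) s' alpha' \o partial alpha (h |: alpha) h)%VF
  end.

(* nu in {0,1}^V is given as the set of vertices v with nu_v = 1. *)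
Definition alpha_of nu : {set half_edge G} := [set h | vertex_of h \in nu].

Definition delta_comp nu nu' (v : vertex G) :
    'Hom(Ahat (alpha_of nu), Ahat (alpha_of nu')) :=
  partial_path (alpha_of nu) (step_order o nu v) (alpha_of nu').

Definition sign_exponent nu (v : vertex G) : nat :=
  #|[set w in nu | (vertex_rank o w < vertex_rank o v)%N]|.

Definition cube (i : nat) : finType := {nu : {set vertex G} | #|nu| == i}.

(* The direct sum of the [Ahat (alpha_of nu)] over |nu| = i, on the disjoint   *)
(* union of their bases.                                                       *)
Definition chain (i : nat) : vectType C :=
  {ffun {nu : cube i & monomial (alpha_of (val nu))} -> C^o}.

Definition component i (u : chain i) (nu : cube i) : Ahat (alpha_of (val nu)) :=
  [ffun k => u (Tagged (fun nu : cube i => monomial (alpha_of (val nu))) k)].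

Definition delta_fun i (u : chain i) : chain i.+1 :=
  [ffun g => \sum_(nu : cube i)
     \sum_(v | (v \notin val nu) && (v |: val nu == val (tag g)))
       (-1) ^+ sign_exponent (val nu) v *
       delta_comp (val nu) (val (tag g)) v (component u nu) (tagged g)].

Fact delta_fun_linear i : linear (@delta_fun i).
Proof.
move=> a u v; apply/ffunP=> g; rewrite !ffunE scaler_sumr -big_split /=.
apply: eq_bigr => nu _; rewrite scaler_sumr -big_split /=.
apply: eq_bigr => w _; have -> : component (a *: u + v) nu
    = a *: component u nu + component v nu by apply/ffunP=> k; rewrite !ffunE.
by rewrite linearP !ffunE mulrDr scalerAr.
Qed.

HB.instance Definition _ i :=
  GRing.isLinear.Build C (chain i) (chain i.+1) *:%R
    (@delta_fun i) (@delta_fun_linear i).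

Definition delta i : 'Hom(chain i, chain i.+1) := linfun (@delta_fun i).

(* The quotient of the cycles by the boundaries, realized as a complement of   *)
(* the boundaries in the cycles.                                               *)
Definition VCH (i : nat) : {vspace chain i} :=
  match i with
  | 0 => lker (delta 0)
  | j.+1 => (lker (delta j.+1) :\: limg (delta j))%VS
  end.

End Complex.

(* Main.v *)
(* For n = 2 the idempotents (1 + x)/2 and (1 - x)/2 diagonalize the            *)
(* multiplication, the comultiplication and eta: the tensor products of        *)
(* idempotents are the 2-colorings of the boundary circles, and a half-twist   *)
(* at h sends a coloring to a nonzero multiple of itself if both sides of the  *)
(* band at h have the same color, and to 0 otherwise. So the kernel of the     *)
(* degree-zero differential has as basis the 2-colorings of the faces in which *)
(* no vertex is surrounded by a single color. At a trivalent vertex an even    *)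
(* number of bands separate the two colors, hence exactly two, and the edges   *)
(* with the same color on both sides form a perfect matching. Conversely, the  *)
(* complement of a perfect matching is a cycle mod 2, hence on the sphere the  *)
(* boundary of exactly two (complementary) sets of faces.                      *)

From HB Require Import structures.
Require Import Defs.
From mathcomp Require Import all_boot all_order all_fingroup all_algebra.
From mathcomp Require Import complex reals.

Set Implicit Arguments.
Unset Strict Implicit.
Unset Printing Implicit Defensive.

Import Order.TTheory GRing.Theory Num.Theory.

Local Open Scope ring_scope.

(** * Boundary circles under a half-twist *)

(** Multiplication by x on the circle of a given flag commutes with all half-twist maps, so joint
    eigenvectors of these operators diagonalize the complex. Their eigenvalues are recorded as a
    function on flags ([eigen]), because the flags, unlike the circles, are the same in all states.
    By [one_circle_step] a half-twist never turns two circles into two circles; this gives the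
    commutation and [partial_neq0E]: an eigenvector survives exactly when the two sides of the
    twisted band have equal colors. Eigenvectors with different colors are orthogonal, so the kernel
    in degree 0 is spanned by the characters that it contains, and [dim_VCH0] counts the face
    colorings with both colors around every vertex. [card_two_colorings] maps such a coloring to the
    set of edges with equal colors on both sides. Parity at a trivalent vertex makes this set a
    perfect matching ([perfect_matching_same_sides]), and the vanishing of the first mod 2 homology
    of the sphere ([vertex_sum_exact]) makes every fibre a pair of complementary colorings
    ([card_same_sides]). *)

(** The involution exchanges the elements of [A] that satisfy [p] with those that do not. *)
Lemma even_card_involution (T : finType) (A : {set T}) (i : T -> T) (p : pred T) :
  involutive i -> (forall x, x \in A -> i x \in A) ->
  (forall x, x \in A -> p (i x) = ~~ p x) -> ~~ odd #|A|.
Proof.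
move=> iK iA ip; rewrite -(cardsID [set x | p x]).
have -> : A :\: [set x | p x] = i @: (A :&: [set x | p x]).
  apply/setP=> x; apply/idP/imsetP => [|[y]]; rewrite !inE.
    case/andP=> px Ax; exists (i x); rewrite ?iK // !inE iA //= ip //.
  by case/andP=> Ay py ->; rewrite iA // ip // py.
by rewrite card_imset ?addnn ?odd_double //; apply: inv_inj.
Qed.

Section Boundary.
Variables (G : multigraph) (Gamma : ribbon_graph G).
Implicit Types (alpha : {set half_edge G}) (h : half_edge G) (f g : flag G).

Lemma oppositeK : involutive (@opposite G).
Proof. by case=> e b; rewrite /opposite /= negbK. Qed.

Lemma cornerK : involutive (corner Gamma).
Proof. by case=> [[h|z] [|]] //=; rewrite ?permK ?permKV. Qed.

Lemma sideK alpha : involutive (side Gamma alpha).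
Proof.
by case=> [[h|z] b] /=; rewrite ?oppositeK -addbA addbb addbF.
Qed.

Definition on_edge (e : edge G) f := if f.1 is inl h then h.1 == e else false.

Lemma on_edge_side alpha e f : on_edge e (side Gamma alpha f) = on_edge e f.
Proof. by case: f => [[h|z] b]. Qed.

Lemma boundary_rel_sym alpha : symmetric (boundary_rel Gamma alpha).
Proof.
by move=> f g; apply/orP/orP => -[] /eqP->;
  rewrite ?cornerK ?sideK; [left|right|left|right].
Qed.

Lemma boundary_connect_sym alpha : connect_sym (boundary_rel Gamma alpha).
Proof. exact: sym_connect_sym (boundary_rel_sym alpha). Qed.

Lemma eq_circle_of alpha f g :
  (circle_of Gamma alpha f == circle_of Gamma alpha g)
    = connect (boundary_rel Gamma alpha) f g.
Proof.
apply/eqP/idP => [/(congr1 val)/= /setP/(_ g)|fg].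
  by rewrite !inE connect0.
apply/val_inj/setP=> x; rewrite !inE.
by rewrite (same_connect (boundary_connect_sym alpha) fg).
Qed.

Lemma circle_of_surj alpha (z : circle Gamma alpha) :
  exists f, z = circle_of Gamma alpha f.
Proof.
by case: z => c cP; case/imsetP: (cP) => f _ def_c; exists f; apply/val_inj.
Qed.

Lemma circle_of_corner alpha f :
  circle_of Gamma alpha (corner Gamma f) = circle_of Gamma alpha f.
Proof.
by apply/esym/eqP; rewrite eq_circle_of connect1 //; apply/orP; left.
Qed.

Lemma circle_of_side alpha f :
  circle_of Gamma alpha (side Gamma alpha f) = circle_of Gamma alpha f.
Proof.
by apply/esym/eqP; rewrite eq_circle_of connect1 //; apply/orP; right.
Qed.

Definition affected alpha h f :=
  (circle_of Gamma alpha f == circle_of Gamma alpha (inl h, false)) ||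
  (circle_of Gamma alpha f == circle_of Gamma alpha (inl h, true)).

Lemma affected_on_edge alpha h f : on_edge h.1 f -> affected alpha h f.
Proof.
have aff_h b : affected alpha h (inl h, b).
  by rewrite /affected; case: b; rewrite eqxx ?orbT.
case: f => [[h'|//] b] /= /eqP eh'.
have [->|neq] := eqVneq h' h; first exact: aff_h.
have -> : h' = opposite h.
  move: eh' neq; rewrite /opposite; case: h' h {aff_h} => [e x] [e' y] /= ->.
  by rewrite xpair_eqE eqxx; case: x y => [] [].
rewrite /affected -!(circle_of_side alpha (inl (opposite h), b)) /= oppositeK.
exact: aff_h.
Qed.

Section Step.
Variables (alpha alpha' : {set half_edge G}) (h : half_edge G).
Hypothesis side_eq :
  forall f, ~~ on_edge h.1 f -> side Gamma alpha f = side Gamma alpha' f.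

(** A walk from an unaffected flag never meets the band of [h], and off this band the two states
    have the same sides. The states are kept arbitrary so that the argument applies in both
    directions. *)
Lemma unaffected_connect f g : ~~ affected alpha h f ->
  connect (boundary_rel Gamma alpha') f g -> connect (boundary_rel Gamma alpha) f g.
Proof.
move=> unf /connectP[p pP ->{g}]; elim: p f unf pP => //= g p IHp f unf.
case/andP=> fg pP; have {}fg: boundary_rel Gamma alpha f g.
  have ne : ~~ on_edge h.1 f by apply: contra unf; apply: affected_on_edge.
  by rewrite /boundary_rel /= side_eq.
apply: connect_trans (connect1 fg) (IHp g _ pP).
have /eqP circ_fg: circle_of Gamma alpha f == circle_of Gamma alpha g.
  by rewrite eq_circle_of connect1.
by rewrite /affected -circ_fg.
Qed.

Lemma unaffected_step f : ~~ affected alpha h f -> ~~ affected alpha' h f.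
Proof.
move=> unf; apply: contra (unf); rewrite /affected !eq_circle_of.
by case/orP=> /(unaffected_connect unf) ->; rewrite ?orbT.
Qed.
End Step.

Section HalfTwist.
Variables (alpha : {set half_edge G}) (h : half_edge G).
Hypothesis h_notin : h \notin alpha.

Lemma half_twisted_step e :
  half_twisted Gamma (h |: alpha) e = half_twisted Gamma alpha e (+) (h.1 == e).
Proof.
move: h_notin; rewrite /half_twisted !inE; case: h => e' b.
rewrite !xpair_eqE; have [->|ne] := eqVneq e' e; last first.
  by rewrite ?andbF /= addbF.
by rewrite /=; case: b => /negPf-> /=;
  case: (twist _ _); case: (_ \in alpha).
Qed.

Lemma side_step f : ~~ on_edge h.1 f ->
  side Gamma alpha f = side Gamma (h |: alpha) f.
Proof.
case: f => [[h'|//] b]; rewrite /on_edge /= half_twisted_step eq_sym => /negPf->.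
by rewrite addbF.
Qed.

Lemma affected_step f : affected (h |: alpha) h f = affected alpha h f.
Proof.
apply/idP/idP; apply: contraLR; apply: unaffected_step => // g ne.
  exact: side_step.
by rewrite side_step.
Qed.

Lemma unaffected_eq_circle f g : ~~ affected alpha h f ->
  (circle_of Gamma (h |: alpha) f == circle_of Gamma (h |: alpha) g) =
  (circle_of Gamma alpha f == circle_of Gamma alpha g).
Proof.
move=> unf; rewrite !eq_circle_of; apply/idP/idP.
  by apply: unaffected_connect unf => e ne; apply: side_step.
apply: (@unaffected_connect _ _ h) => [e ne|]; first by rewrite side_step.
by rewrite affected_step.
Qed.

(* Cutting the band of [h] leaves arcs between the four ends of its sides, so  *)
(* a component has an even number of these ends: the arc starting at one side  *)
(* of [h] ends either at its other side, or at one of the sides of the         *)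
(* opposite half-edge, which is joined to the other side of [h] in one of the  *)
(* two states.                                                                 *)
Lemma one_circle_step :
  circle_of Gamma alpha (inl h, false) = circle_of Gamma alpha (inl h, true) \/
  circle_of Gamma (h |: alpha) (inl h, false) =
    circle_of Gamma (h |: alpha) (inl h, true).
Proof.
pose cut : rel (flag G) := fun f g =>
  (g == corner Gamma f) || ~~ on_edge h.1 f && (g == side Gamma alpha f).
have cut_sub f g : connect cut f g ->
    connect (boundary_rel Gamma alpha) f g /\
    connect (boundary_rel Gamma (h |: alpha)) f g.
  move=> fg; split; apply: connect_sub fg => x y /orP[/eqP->|/andP[ne /eqP->]];
    apply: connect1; rewrite /boundary_rel /= ?eqxx ?orbT //.
  by rewrite side_step // eqxx orbT.
(* Only flags at half-edges are kept: there [corner] always changes the Boolean, whereas it fixes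
   the flags of a vertex-less edge. *)
pose A := [set f | connect cut (inl h, false) f
                 & if f.1 is inl _ then true else false].
have A_corner f : f \in A -> corner Gamma f \in A.
  rewrite !inE => /andP[cf fl]; apply/andP; split; last first.
    by case: f fl {cf} => [[k|z] []].
  by apply: connect_trans cf (connect1 _); rewrite /cut eqxx.
have A_side f : f \in A -> ~~ on_edge h.1 f -> side Gamma alpha f \in A.
  rewrite !inE => /andP[cf fl] ne; apply/andP; split; last first.
    by case: f fl {cf ne} => [[k|z] b].
  by apply: connect_trans cf (connect1 _); rewrite /cut ne eqxx orbT.
have evenA : ~~ odd #|A|.
  apply: (even_card_involution cornerK A_corner (p := fun f => f.2)).
  by move=> [[k|z] []]; rewrite inE //= andbF.
have evenD : ~~ odd #|A :\: [set f | on_edge h.1 f]|.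
  apply: (even_card_involution (sideK alpha)
    (p := fun f => if f.1 is inl k then k.2 else false)) => [f|].
    by rewrite !in_setD !inE on_edge_side => /andP[ne Af]; rewrite ne /=;
      have:= A_side f; rewrite !inE; apply.
  by move=> [[k|z] b]; rewrite !inE //= !andbF.
have evenI : ~~ odd #|A :&: [set f | on_edge h.1 f]|.
  move: evenA; rewrite -(cardsID [set f | on_edge h.1 f]) oddD.
  by rewrite (negPf evenD) addbF.
have h0A : (inl h, false) \in A :&: [set f | on_edge h.1 f].
  by rewrite !inE connect0 /on_edge /=.
have : exists2 f, f \in A :&: [set f | on_edge h.1 f] & f != (inl h, false).
  move: evenI; rewrite (cardsD1 (inl h, false)) h0A oddD /= negbK => odd1.
  have /card_gt0P[f]: (0 < #|(A :&: [set f | on_edge h.1 f]) :\ (inl h, false)|)%N.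
    by case: #|_| odd1.
  by rewrite in_setD1 => /andP[nf Af]; exists f.
case=> -[x b]; rewrite in_setI !inE => /andP[/andP[/cut_sub[c1 c2]]].
case: x c1 c2 => // k c1 c2 _; rewrite /on_edge /= => /eqP ek.
have [kh|neq] := eqVneq k h.
  rewrite {}kh {ek} in c1 c2 *; case: b c1 c2 => [c1 _ _|_ _]; last by rewrite eqxx.
  by left; apply/eqP; rewrite eq_circle_of.
have {neq ek} dk : k = opposite h.
  move: ek neq {c1 c2 h0A}; rewrite /opposite; case: k h => [e x] [e' y] /= ->.
  by rewrite xpair_eqE eqxx; case: x y => [] [].
rewrite {}dk in c1 c2 * => _.
move: c1 c2; rewrite -!eq_circle_of -(circle_of_side alpha (inl _, b))
  -(circle_of_side (h |: alpha) (inl _, b)) /= oppositeK half_twisted_step eqxx.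
by case: b; case: (half_twisted _ _ _) => /= /eqP c1 /eqP c2; by [left|right].
Qed.

End HalfTwist.
End Boundary.

(** * Diagonalization of the half-twist maps *)

Lemma ord2P (P : 'I_2 -> Prop) : P 0 -> P 1 -> forall i, P i.
Proof.
move=> P0 P1 i; have [->//|i1] := eqVneq i 0; suff -> : i = 1 by [].
by apply/val_inj; case: i i1 => [[|[|]]].
Qed.

Lemma addr1_ord2K : involutive (fun i : 'I_2 => i + 1).
Proof. by apply: ord2P; apply/val_inj. Qed.

Section Coefficients.
Variable C : numClosedFieldType.
Implicit Types i j k : 'I_2.

(** Adding 1 to an exponent is multiplication by x; this and the next four lemmas say that the three
    structure maps are linear over the algebra. *)
Lemma mu_coef_addl i j k : mu_coef C (i + 1) j (k + 1) = mu_coef C i j k.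
Proof. by move: i j k; do 3!apply: ord2P. Qed.

Lemma mu_coef_addr i j k : mu_coef C i (j + 1) (k + 1) = mu_coef C i j k.
Proof. by move: i j k; do 3!apply: ord2P. Qed.

Lemma Delta_coef_addl k i j : Delta_coef C (k + 1) (i + 1) j = Delta_coef C k i j.
Proof. by move: k i j; do 3!apply: ord2P. Qed.

Lemma Delta_coef_addr k i j : Delta_coef C (k + 1) i (j + 1) = Delta_coef C k i j.
Proof. by move: k i j; do 3!apply: ord2P. Qed.

Lemma eta_coef_add k l : eta_coef C (k + 1) (l + 1) = eta_coef C k l.
Proof. by move: k l; do 2!apply: ord2P. Qed.

(** The second factor of [partial_coef], with arbitrary types in place of the circles of the two
    states. *)
Definition step_coef (Z Z' : eqType) (a0 a1 : Z) (b0 b1 : Z')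
    (k : Z -> 'I_2) (k' : Z' -> 'I_2) : C :=
  if a0 != a1 then mu_coef C (k a0) (k a1) (k' b0)
  else if b0 != b1 then Delta_coef C (k a0) (k' b0) (k' b1)
  else eta_coef C (k a0) (k' b0).

(* [x] and [y] stand for the circles of one flag before and after the          *)
(* half-twist.                                                                 *)
Lemma step_coef_flip (Z Z' : eqType) (a0 a1 x : Z) (b0 b1 y : Z')
    (k l : Z -> 'I_2) (k' l' : Z' -> 'I_2) :
  a0 = a1 \/ b0 = b1 ->
  (y == b0) || (y == b1) = (x == a0) || (x == a1) ->
  (forall z, l z = if z == x then k z + 1 else k z) ->
  (forall z, l' z = if z == y then k' z + 1 else k' z) ->
  step_coef a0 a1 b0 b1 l l' = step_coef a0 a1 b0 b1 k k'.
Proof.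
rewrite /step_coef !(eq_sym x) !(eq_sym y) => one + lE l'E.
rewrite !lE !l'E.
have [eq_a|ne_a] := eqVneq a0 a1.
  rewrite /= -eq_a orbb; have [eq_b|ne_b] := eqVneq b0 b1.
    by rewrite /= -eq_b orbb => ->; case: ifP => // _; rewrite eta_coef_add.
  have : ~~ ((b0 == y) && (b1 == y)).
    by apply: contra ne_b => /andP[/eqP-> /eqP->].
  case: (b0 == y); case: (b1 == y) => //= _ <- //.
    by rewrite Delta_coef_addl.
  by rewrite Delta_coef_addr.
case: one => [/eqP|eq_b]; first by rewrite (negPf ne_a).
have : ~~ ((a0 == x) && (a1 == x)).
  by apply: contra ne_a => /andP[/eqP-> /eqP->].
rewrite /= -eq_b orbb.
case: (a0 == x); case: (a1 == x) => //= _ -> //.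
  by rewrite mu_coef_addl.
by rewrite mu_coef_addr.
Qed.
End Coefficients.

(** * Multiplication by x on one circle, in the monomial basis *)

Section Flip.
Variables (G : multigraph) (Gamma : ribbon_graph G).
Implicit Type alpha : {set half_edge G}.
Implicit Type f : flag G.

Definition flip alpha f (k : monomial Gamma 2 alpha) : monomial Gamma 2 alpha :=
  [ffun z => if z == circle_of Gamma alpha f then k z + 1 else k z].

Definition monomial1 alpha : monomial Gamma 2 alpha := [ffun=> 0].

Lemma flipE alpha f k z :
  @flip alpha f k z = if z == circle_of Gamma alpha f then k z + 1 else k z.
Proof. exact: ffunE. Qed.

Lemma flipK alpha f : involutive (@flip alpha f).
Proof.
by move=> k; apply/ffunP=> z; rewrite !flipE; case: eqP => // _; rewrite addr1_ord2K.
Qed.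

Lemma flip_at alpha f k :
  flip f k (circle_of Gamma alpha f) = k (circle_of Gamma alpha f) + 1.
Proof. by rewrite flipE eqxx. Qed.

Lemma flip_off alpha f k z :
  z != circle_of Gamma alpha f -> flip f k z = k z.
Proof. by rewrite flipE => /negPf->. Qed.

(** Matrix form of the commutation of the half-twist map with multiplication by x at one and the
    same flag: unaffected circles correspond in the two states, and the affected ones are handled by
    [step_coef_flip]. *)
Lemma partial_coef_flip (C : numClosedFieldType) alpha h f
    (k : monomial Gamma 2 alpha) (k' : monomial Gamma 2 (h |: alpha)) :
  h \notin alpha ->
  partial_coef C h (flip f k) (flip f k') = partial_coef C h k k'.
Proof.
move=> hN; rewrite /partial_coef; congr (_ * _); last first.
  exact: step_coef_flip (one_circle_step Gamma hN) (affected_step Gamma hN f)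
    (flipE f k) (flipE f k').
congr (nat_of_bool _)%:R; apply: eq_forallb => g; rewrite !inE.
have [//|/= unf] := boolP (_ || _); rewrite !flipE.
rewrite (unaffected_eq_circle hN f (unf : ~~ affected Gamma alpha h g)).
case: (circle_of Gamma alpha g == _) => //.
by rewrite (inj_eq (addIr 1)).
Qed.

End Flip.

Section Eigen.
Variables (C : numClosedFieldType) (G : multigraph) (Gamma : ribbon_graph G).
Implicit Types (alpha : {set half_edge G}) (f g : flag G) (h : half_edge G).
Implicit Type c : flag G -> 'I_2.

(* The flip of [f] is the multiplication by x in the factor of the circle of   *)
(* [f], so [eigen c u] means that this x acts on u by the root of unity        *)
(* (-1) ^ (c f).                                                               *)
Definition eigen alpha c (u : Ahat C Gamma 2 alpha) :=
  forall f k, u (flip f k) = (-1) ^+ c f * u k.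

Lemma sign_ord2_inj : injective (fun i : 'I_2 => (-1) ^+ i : C).
Proof.
have N11 : (1 : C) <> -1 by move/eqP; rewrite -subr_eq0 opprK (pnatr_eq0 C 2).
by apply: ord2P; apply: ord2P => //=; rewrite expr0 expr1 // => /esym.
Qed.

(** Every monomial is reached from 1 by flips, each of which changes the coefficient only by a sign.
    The induction is on the number of circles carrying an x. *)
Lemma eigen_sqr alpha c (u : Ahat C Gamma 2 alpha) k :
  eigen c u -> u k ^+ 2 = u (monomial1 Gamma alpha) ^+ 2.
Proof.
move=> cu; have [n le_n] := ubnP #|[set z | k z != 0]|.
elim: n k le_n => // n IHn k; rewrite ltnS => le_n.
have [k0|[z]] := set_0Vmem [set z | k z != 0].
  congr (u _ ^+ 2); apply/ffunP=> z; rewrite ffunE; apply/eqP.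
  by move/setP/(_ z): k0; rewrite !inE => /negbFE.
rewrite inE => kz; have [f def_z] := circle_of_surj z.
rewrite -(IHn (flip f k)); first by rewrite cu exprMn sqrr_sign mul1r.
apply: leq_trans le_n; apply/proper_card/properP; split; last first.
  exists z; rewrite !inE // def_z flip_at -def_z.
  by move: (k z) kz; apply: ord2P.
apply/subsetP=> y; rewrite !inE; have [->//|ne] := eqVneq y z.
by rewrite flipE -def_z (negPf ne).
Qed.

Lemma eigen_neq0 alpha c (u : Ahat C Gamma 2 alpha) :
  eigen c u -> (u != 0) = (u (monomial1 Gamma alpha) != 0).
Proof.
move=> cu; apply/idP/idP; last by apply: contraNneq => ->; rewrite ffunE.
apply: contraNneq => u0; apply/eqP/ffunP=> k; rewrite ffunE.
by have /eqP := eigen_sqr k cu; rewrite u0 expr0n expf_eq0 => /eqP.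
Qed.

(** Flags on one circle define the same operator, which has only one eigenvalue on a nonzero
    vector. *)
Lemma eigen_eq0 alpha c (u : Ahat C Gamma 2 alpha) f g :
  eigen c u -> circle_of Gamma alpha f = circle_of Gamma alpha g ->
  c f != c g -> u = 0.
Proof.
move=> cu fg; apply: contraNeq; rewrite (eigen_neq0 cu) => u0.
apply/eqP/sign_ord2_inj/(mulIf u0); rewrite -!cu; congr (u _).
by apply/ffunP=> z; rewrite !flipE fg.
Qed.

(** Bilinear, without conjugation: by [eigen_sqr] a nonzero eigenvector is still not isotropic. *)
Definition dot alpha (u v : Ahat C Gamma 2 alpha) : C := \sum_k u k * v k.

(** [flip f] permutes the monomials, so it preserves [dot]; with opposite eigenvalues [dot u v]
    equals its own negative. *)
Lemma eigen_orthogonal alpha c d (u v : Ahat C Gamma 2 alpha) f :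
  eigen c u -> eigen d v -> c f != d f -> dot u v = 0.
Proof.
move=> cu dv cd; suff /eqP: dot u v *+ 2 = 0 by rewrite mulrn_eq0 => /eqP.
rewrite mulr2n {1}/dot (reindex_inj (inv_inj (flipK f))) -big_split /= big1 //.
move=> k _; rewrite cu dv mulrACA.
suff -> : (-1) ^+ c f * (-1) ^+ d f = -1 :> C by rewrite mulN1r addNr.
by move: (c f) (d f) cd; do 2!apply: ord2P => //; rewrite expr0 expr1 ?mulr1 ?mul1r.
Qed.

Lemma eigen_dot_neq0 alpha c (u : Ahat C Gamma 2 alpha) :
  eigen c u -> u != 0 -> dot u u != 0.
Proof.
move=> cu; rewrite (eigen_neq0 cu) => u0; rewrite /dot.
under eq_bigr => k _ do rewrite -expr2 (eigen_sqr k cu).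
rewrite sumr_const mulrn_eq0 negb_or expf_eq0 u0 andbT -lt0n.
by apply/card_gt0P; exists (monomial1 Gamma alpha).
Qed.

Section Partial.
Variables (alpha : {set half_edge G}) (h : half_edge G).
Hypothesis h_notin : h \notin alpha.
Variables (c : flag G -> 'I_2) (u : Ahat C Gamma 2 alpha).
Hypothesis cu : eigen c u.

Lemma eigen_partial : eigen c (partial C Gamma 2 alpha (h |: alpha) h u).
Proof.
move=> f k'; rewrite !lfunE /= !ffunE (reindex_inj (inv_inj (flipK f))) mulr_sumr.
by apply: eq_bigr => k _; rewrite partial_coef_flip // cu -mulrA.
Qed.

(** The two sides of the band lie on one circle before or after the half-twist, so [eigen_eq0] kills
    either [u] or its image. *)
Lemma partial_eq0 : c (inl h, false) != c (inl h, true) ->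
  partial C Gamma 2 alpha (h |: alpha) h u = 0.
Proof.
move=> ch; case: (one_circle_step Gamma h_notin) => [eq_a|eq_b].
  by rewrite (eigen_eq0 cu eq_a ch) linear0.
exact: eigen_eq0 eigen_partial eq_b ch.
Qed.

(** The image is again an eigenvector, so it suffices that its coefficient at [monomial1] is
    nonzero. *)
Lemma partial_neq0 : c (inl h, false) = c (inl h, true) -> u != 0 ->
  partial C Gamma 2 alpha (h |: alpha) h u != 0.
Proof.
move=> ch; rewrite (eigen_neq0 cu) (eigen_neq0 eigen_partial) => u0.
rewrite lfunE ffunE /= /partial_coef.
set a0 := circle_of Gamma alpha _; set a1 := circle_of Gamma alpha (_, true).
set b0 := circle_of Gamma _ (_, false); set b1 := circle_of Gamma _ (_, true).
pose k0 := monomial1 Gamma alpha.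
have off (k : monomial Gamma 2 alpha) : [forall f,
    (circle_of Gamma alpha f \notin [:: a0; a1]) ==>
    (monomial1 Gamma (h |: alpha) (circle_of Gamma (h |: alpha) f)
       == k (circle_of Gamma alpha f))] =
    [forall z, (z \notin [:: a0; a1]) ==> (k z == 0)].
  apply/forallP/forallP => [k_off z|k_off f].
    by have [f ->] := circle_of_surj z; have:= k_off f; rewrite ffunE eq_sym.
  by have:= k_off (circle_of Gamma alpha f); rewrite ffunE eq_sym.
under eq_bigr => k _ do rewrite off !ffunE.
have [eq_a|ne_a] /= := eqVneq a0 a1.
  have k_eq (k k1 : monomial Gamma 2 alpha) :
      (forall z, (z \notin [:: a0; a1]) ==> (k z == 0)) ->
      (forall z, z != a0 -> k1 z = 0) -> k a0 = k1 a0 -> k = k1.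
    move=> k_off k1_off k01; apply/ffunP=> z; have [->//|ne] := eqVneq z a0.
    rewrite k1_off //; apply/eqP; apply: (implyP (k_off z)).
    by rewrite !inE -eq_a orbb.
  have [eq_b|ne_b] := eqVneq b0 b1.
    (* One circle stays one circle: eta shifts the exponent by m = 1, so the monomial 1 comes only
       from x. *)
    rewrite (big_only1 (flip (inl h, false) k0)) //.
      have -> : [forall z, (z \notin [:: a0; a1]) ==>
          (flip (inl h, false) k0 z == 0)].
        apply/forallP=> z; apply/implyP; rewrite !inE -eq_a orbb => ne.
        by rewrite flip_off // ffunE.
      rewrite flip_at ffunE cu mul1r /eta_coef /=.
      by rewrite !mulf_neq0 ?signr_eq0 ?sqrtC_eq0 ?pnatr_eq0 ?oner_neq0.
    move=> k + _; apply: contraNeq; case: forallP => [k_off|_]; last first.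
      by rewrite mul0r mulr0 eqxx.
    move=> nz; apply/eqP/k_eq => // [z ne|]; first by rewrite flip_off // ffunE.
    rewrite flip_at ffunE; move: nz; rewrite /eta_coef; move: (k a0).
    by apply: ord2P => /=; rewrite ?mulr0 ?eqxx ?add0r.
  (* A split: Delta(1) contains the product of 1 with 1, and Delta(x) does not. *)
  rewrite (big_only1 k0) //.
    have -> : [forall z, (z \notin [:: a0; a1]) ==> (k0 z == 0)].
      by apply/forallP=> z; rewrite ffunE eqxx implybT.
    by rewrite ffunE /Delta_coef /= !mulr1.
  move=> k + _; apply: contraNeq; case: forallP => [k_off|_]; last first.
    by rewrite mul0r mulr0 eqxx.
  move=> nz; apply/eqP/k_eq => // [z _|]; first by rewrite ffunE.
  rewrite ffunE; move: nz; rewrite /Delta_coef; move: (k a0).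
  by apply: ord2P => /=; rewrite ?mulr0 ?eqxx ?add0r.
(* A merge: 1 arises from the pair 1, 1 and from the pair x, x. Since the two colors agree, [u] has
   the same coefficient at both, and the terms add up to twice this coefficient. *)
pose k1 := flip (inl h, false) (flip (inl h, true) k0).
have k1_a0 : k1 a0 = 1 by rewrite flip_at flip_off // ffunE add0r.
have k1_a1 : k1 a1 = 1 by rewrite flip_off 1?eq_sym // flip_at ffunE add0r.
have k1_off z : z \notin [:: a0; a1] -> k1 z = 0.
  rewrite !inE negb_or => /andP[n0 n1].
  by rewrite !flipE (negPf n0) (negPf n1) ffunE.
have k01 : k1 != k0 by apply/eqP=> /ffunP/(_ a0); rewrite k1_a0 ffunE.
rewrite (bigD1 k0) //= (bigD1 k1) //= big1 ?addr0.
  have -> : [forall z, (z \notin [:: a0; a1]) ==> (k0 z == 0)].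
    by apply/forallP=> z; rewrite ffunE eqxx implybT.
  have -> : [forall z, (z \notin [:: a0; a1]) ==> (k1 z == 0)].
    by apply/forallP=> z; apply/implyP => /k1_off->.
  rewrite k1_a0 k1_a1 !ffunE !cu ch signrMK /mu_coef /= !mulr1.
  by rewrite -mulr2n mulrn_eq0.
move=> k /andP[nk0 nk1]; apply/eqP; apply: contraNT nk1.
case: forallP => [k_off|_]; last by rewrite mul0r mulr0 eqxx.
move=> nz; have k_a : k a0 = k a1.
  by move: nz; rewrite /mu_coef; move: (k a0) (k a1); do 2!apply: ord2P => //=;
    rewrite !mulr0 eqxx.
have ka0 : k a0 = 1.
  have: k a0 != 0.
    apply: contraNneq nk0 => ka0; apply/eqP/ffunP=> z; rewrite ffunE.
    have:= k_off z; rewrite !inE; have [->//|_] := eqVneq z a0.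
    by have [->|_ /eqP//] := eqVneq z a1; rewrite -k_a.
  by move: (k a0); apply: ord2P.
apply/eqP/ffunP=> z; have [->|n0] := eqVneq z a0; first by rewrite k1_a0.
have [->|n1] := eqVneq z a1; first by rewrite k1_a1 -k_a.
have zN : z \notin [:: a0; a1] by rewrite !inE negb_or n0.
by rewrite k1_off //; apply/eqP; apply: (implyP (k_off z)).
Qed.

End Partial.

End Eigen.

Section Path.
Variables (C : numClosedFieldType) (G : multigraph) (Gamma : ribbon_graph G).
Implicit Types (alpha : {set half_edge G}) (f g : flag G) (h : half_edge G).

Lemma partial_neq0E alpha h (c : flag G -> 'I_2) (u : Ahat C Gamma 2 alpha) :
  h \notin alpha -> eigen c u ->
  (partial C Gamma 2 alpha (h |: alpha) h u != 0) =
    (u != 0) && (c (inl h, false) == c (inl h, true)).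
Proof.
move=> hN cu; have [ch|ch] := eqVneq (c (inl h, false)) (c (inl h, true)).
  rewrite andbT; apply/idP/idP; last exact: partial_neq0.
  by apply: contraNneq => ->; rewrite linear0.
by rewrite (partial_eq0 hN cu ch) eqxx andbF.
Qed.

(** Iterates [partial_neq0E], with one [c] for all states on the path. The path must be nonempty, as
    [partial_path] is 0 on the empty one. *)
Lemma eigen_path alpha' s alpha (c : flag G -> 'I_2) (u : Ahat C Gamma 2 alpha) :
  s != [::] -> uniq s -> {in s, forall h, h \notin alpha} ->
  alpha' = alpha :|: [set h in s] -> eigen c u ->
  eigen c (partial_path C Gamma 2 alpha s alpha' u) /\
  (partial_path C Gamma 2 alpha s alpha' u != 0) =
    (u != 0) && all (fun h => c (inl h, false) == c (inl h, true)) s.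
Proof.
elim: s alpha u => // h [|h' s] IHs alpha u _.
  move=> _ hN -> cu; have {}hN : h \notin alpha by rewrite hN ?mem_head.
  have -> : alpha :|: [set x in [:: h]] = h |: alpha.
    by apply/setP=> x; rewrite !inE orbC.
  by rewrite /= andbT -partial_neq0E //; split=> //; apply: eigen_partial.
rewrite cons_uniq => /andP[hs us] hN def_alpha' cu.
have hNalpha : h \notin alpha by rewrite hN ?mem_head.
have cpu := eigen_partial hNalpha cu; have nz := partial_neq0E hNalpha cu.
have -> : partial_path C Gamma 2 alpha [:: h, h' & s] alpha' u =
  partial_path C Gamma 2 (h |: alpha) (h' :: s) alpha'
    (partial C Gamma 2 alpha (h |: alpha) h u) by exact: comp_lfunE.
move: (partial _ _ _ _ _ _ u) cpu nz => v cv nz.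
have [||cPv ->] := IHs (h |: alpha) v isT us _ _ cv.
- move=> x xs; rewrite in_setU1; apply/norP; split; last first.
    by apply: hN; rewrite in_cons xs orbT.
  by apply: contraNneq hs => <-.
- by rewrite def_alpha'; apply/setP=> x; rewrite !inE orbCA orbA.
by split=> //; rewrite nz -andbA.
Qed.

End Path.

(** * The kernel in degree zero *)

Section DiagonalKernel.
Variables (F : fieldType) (V W : vectType F) (I : finType) (P : pred I).
Variables (phi : 'Hom(V, W)) (e : I -> V).

(** The last hypothesis says that the images of the basis vectors outside [P] are independent, so
    the kernel is the span of those in [P]. *)
Lemma dim_lker_diag :
  (forall u, exists a : I -> F, u = \sum_i a i *: e i) ->
  (forall a : I -> F, \sum_i a i *: e i = 0 -> forall i, a i = 0) ->
  (forall i, P i -> phi (e i) = 0) ->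
  (forall a : I -> F, phi (\sum_i a i *: e i) = 0 -> forall i, ~~ P i -> a i = 0) ->
  \dim (lker phi) = #|[set i | P i]|.
Proof.
move=> e_span e_free phi0 phiN0.
pose J := {i | i \in P}.
pose S (a : {ffun J -> F^o}) : V := \sum_j a j *: e (val j).
have S_linear : linear S.
  move=> x a b; rewrite /S scaler_sumr -big_split; apply: eq_bigr => j _.
  by rewrite !ffunE scalerDl scalerA.
pose SL : {linear {ffun J -> F^o} -> V} :=
  HB.pack S (GRing.isLinear.Build F {ffun J -> F^o} V *:%R S S_linear).
have SE a : linfun SL a = S a by rewrite lfunE.
have S_sum (a : {ffun J -> F^o}) : S a =
    \sum_i (if insub i is Some j then a j else 0) *: e i.
  rewrite (bigID (mem P)) /= [X in _ + X]big1 ?addr0; last first.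
    by move=> i Pi; rewrite insubN ?scale0r.
  by rewrite big_sub; apply: eq_bigr => j _; rewrite valK.
have ker0 : lker (linfun SL) == 0%VS.
  apply/eqP/vspaceP=> a; rewrite memv_ker memv0 SE S_sum.
  apply/eqP/eqP=> [/e_free a0|->]; last first.
    by rewrite big1 // => i _; case: insub => [j|]; rewrite ?ffunE scale0r.
  by apply/ffunP=> j; have:= a0 (val j); rewrite valK ffunE.
have -> : lker phi = limg (linfun SL).
  apply/vspaceP=> u; rewrite memv_ker; apply/eqP/memv_imgP => [|[a _ ->]].
    have [a ->] := e_span u => /phiN0 a0.
    exists [ffun j => a (val j)]; rewrite ?memvf // SE S_sum.
    apply: eq_bigr => i _; case: insubP => [j _ <-|/a0->//]; by rewrite ffunE.
  rewrite SE linear_sum big1 // => j _; rewrite linearZ /= phi0 ?scaler0 //.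
  exact: (valP j).
rewrite (limg_dim_eq (U := fullv)); last by rewrite (eqP ker0) capv0.
rewrite dimvf /dim /= muln1 card_sig cardsE; apply: eq_card => i; by rewrite inE.
Qed.
End DiagonalKernel.

(** * The basis of characters of a power of Z/2 *)

Section Characters.
Variables (C : numClosedFieldType) (G : multigraph) (Gamma : ribbon_graph G).
Variable alpha : {set half_edge G}.
Local Notation monomial := (monomial Gamma 2 alpha).
Local Notation Ahat := (Ahat C Gamma 2 alpha).

(** The coefficients of the tensor product over z of 1 + (-1)^(c z) x, that is, of a product of
    idempotents up to a power of 2. *)
Definition character (c : monomial) : Ahat :=
  [ffun k : monomial => \prod_z (-1) ^+ (c z * k z)%N].

Lemma characterE (c k : monomial) : character c k = \prod_z (-1) ^+ (c z * k z)%N.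
Proof. exact: ffunE. Qed.

Lemma characterC (c k : monomial) : character c k = character k c.
Proof. by rewrite !characterE; apply: eq_bigr => z _; rewrite mulnC. Qed.

Lemma eigen_character (c : monomial) :
  eigen (fun f => c (circle_of Gamma alpha f)) (character c).
Proof.
move=> f k; rewrite !characterE (bigD1 (circle_of Gamma alpha f)) //=.
rewrite [in RHS](bigD1 (circle_of Gamma alpha f)) //= mulrA flip_at.
congr (_ * _); last by apply: eq_bigr => z ne; rewrite flip_off.
by move: (c _) (k _); do 2!apply: ord2P;
  rewrite /= ?expr0 ?expr1 ?mulrNN ?mulr1 ?mul1r.
Qed.

Lemma circle_of_neq (c d : monomial) :
  c != d -> exists f, c (circle_of Gamma alpha f) != d (circle_of Gamma alpha f).
Proof.
move=> ne; have [z cd] : exists z, c z != d z.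
  apply/existsP; apply: contraNT ne => /existsPn same.
  by apply/eqP/ffunP=> z; apply/eqP/negbNE/same.
by have [f def_z] := circle_of_surj z; exists f; rewrite -def_z.
Qed.

Lemma dot_character (c d : monomial) :
  dot (character c) (character d) = #|monomial|%:R *+ (c == d).
Proof.
have [->|ne] := eqVneq c d.
  rewrite /dot -sumr_const; apply: eq_bigr => k _.
  rewrite characterE -big_split big1 //= => z _.
  by rewrite -expr2 sqrr_sign.
have [f cd] := circle_of_neq ne.
exact: eigen_orthogonal (eigen_character c) (eigen_character d) cd.
Qed.

Lemma dot_suml (I : finType) (a : I -> C) (u : I -> Ahat) (v : Ahat) :
  dot (\sum_i a i *: u i) v = \sum_i a i * dot (u i) v.
Proof.
rewrite /dot; under [RHS]eq_bigr => i _ do rewrite mulr_sumr.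
rewrite exchange_big; apply: eq_bigr => k _.
by rewrite sum_ffunE mulr_suml; apply: eq_bigr => i _; rewrite ffunE -mulrA.
Qed.

Lemma card_monomial_neq0 : #|monomial|%:R != 0 :> C.
Proof.
by rewrite pnatr_eq0 -lt0n; apply/card_gt0P; exists (monomial1 Gamma alpha).
Qed.

(** Fourier inversion; the symmetry [characterC] turns the sum over characters into the
    orthogonality relation [dot_character]. *)
Lemma character_span (u : Ahat) :
  u = \sum_c (#|monomial|%:R^-1 * dot u (character c)) *: character c.
Proof.
apply/ffunP=> k; rewrite sum_ffunE.
transitivity (#|monomial|%:R^-1 * \sum_l u l * dot (character l) (character k)).
  rewrite (bigD1 k) //= big1 ?addr0 => [|l ne].
    by rewrite dot_character eqxx mulr1n mulrCA mulVf ?mulr1 ?card_monomial_neq0.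
  by rewrite dot_character (negPf ne) mulr0.
transitivity (#|monomial|%:R^-1 * \sum_c dot u (character c) * character c k).
  congr (_ * _).
  under eq_bigr => l _ do rewrite mulr_sumr.
  rewrite exchange_big; apply: eq_bigr => c _; rewrite mulr_suml.
  by apply: eq_bigr => l _; rewrite mulrA (characterC l) (characterC k).
rewrite mulr_sumr; apply: eq_bigr => c _; rewrite mulrA [RHS]ffunE; reflexivity.
Qed.

Lemma character_free (a : monomial -> C) :
  \sum_c a c *: character c = 0 -> forall c, a c = 0.
Proof.
move=> a0 d; apply: (mulIf card_monomial_neq0); rewrite mul0r.
transitivity (dot (\sum_c a c *: character c) (character d)); last first.
  by rewrite a0 /dot big1 // => k _; rewrite ffunE mul0r.
rewrite dot_suml (bigD1 d) //= big1 ?addr0 => [|c ne].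
  by rewrite dot_character eqxx.
by rewrite dot_character (negPf ne) mulr0.
Qed.

End Characters.

(** * The differential on degree zero, in the basis of characters *)

Section DegreeZero.
Variables (C : numClosedFieldType) (G : multigraph) (Gamma : ribbon_graph G).
Variable o : conventions G.
Hypothesis G3 : trivalent G.
Local Notation alpha0 := (@alpha_of G set0).
Local Notation chain i := (chain C Gamma 2 i).
Local Notation delta_at nu' v := (delta_comp C Gamma o 2 set0 nu' v).

Definition empty_state : cube G 0 :=
  exist (fun nu : {set vertex G} => #|nu| == 0)%N set0 (introT eqP (cards0 _)).

Lemma empty_stateP (nu : cube G 0) : nu = empty_state.
Proof. by apply/val_inj/cards0_eq/eqP/(valP nu). Qed.

(** Degree 0 has a single summand, indexed by the empty set; [untag] reads it off without a cast
    between dependent types. *)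
Definition chain0 (u : Ahat C Gamma 2 alpha0) : chain 0 :=
  [ffun g => untag 0
     (fun k : monomial Gamma 2 (alpha_of (val empty_state)) => u k) g].

Lemma chain0E u (k : monomial Gamma 2 (alpha_of (val empty_state))) :
  chain0 u (Tagged (fun nu : cube G 0 => monomial Gamma 2 (alpha_of (val nu))) k) =
    u k.
Proof.
rewrite ffunE; set g := (X in untag _ _ X).
exact: (untagE _ _ (erefl : tag g = empty_state)).
Qed.

Lemma component_chain0 u : component (chain0 u) empty_state = u.
Proof. by apply/ffunP=> k; rewrite ffunE chain0E. Qed.

Lemma chain0_component w : chain0 (component w empty_state) = w.
Proof.
apply/ffunP=> -[nu k]; move: k; rewrite (empty_stateP nu) => k.
by rewrite (chain0E (component w empty_state) k) ffunE.
Qed.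

Fact chain0_linear : linear chain0.
Proof.
move=> a u v; apply/ffunP=> -[nu k]; move: k; rewrite (empty_stateP nu) => k.
rewrite (chain0E (a *: u + v) k) 2!ffunE [RHS]ffunE [in RHS]ffunE.
by rewrite (chain0E u k) (chain0E v k).
Qed.
HB.instance Definition _ :=
  GRing.isLinear.Build C (Ahat C Gamma 2 alpha0) (chain 0) *:%R chain0 chain0_linear.

Lemma delta0E u (nu' : cube G 1) v k : val nu' = [set v] ->
  delta C Gamma o 2 0 (chain0 u)
    (Tagged (fun nu : cube G 1 => monomial Gamma 2 (alpha_of (val nu))) k) =
  delta_at (val nu') v u k.
Proof.
move=> def_nu'; rewrite lfunE ffunE (big_only1 empty_state) //=; last first.
  by move=> nu; rewrite (empty_stateP nu) eqxx.
rewrite (big_only1 v) /=; last first.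
- move=> v' ne /andP[_]; rewrite setU0 => /eqP def_v'.
  by case/eqP: ne; apply: set1_inj (etrans def_v' def_nu').
- by rewrite inE setU0 def_nu' eqxx.
have -> : sign_exponent o set0 v = 0%N.
  by apply: eq_card0 => w; rewrite !inE.
by rewrite expr0 mul1r component_chain0.
Qed.

Lemma delta_at_character v (c : monomial Gamma 2 alpha0) :
  let cf f := c (circle_of Gamma alpha0 f) in
  let w := delta_at [set v] v (character C c) in
  eigen cf w /\
  (w != 0) = [forall h in half_edges_at v, cf (inl h, false) == cf (inl h, true)].
Proof.
move=> cf w; have perm_s := step_orderP o set0 v.
have [|||||cw ->] := @eigen_path C G Gamma (alpha_of [set v]) (step_order o set0 v)
   alpha0 cf (character C c).
- by rewrite -size_eq0 (perm_size perm_s) -cardE G3.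
- by rewrite (perm_uniq perm_s) enum_uniq.
- by move=> h _; rewrite !inE.
- by apply/setP=> h; rewrite !inE (perm_mem perm_s) mem_enum inE.
- exact: eigen_character.
split=> //; have -> : character C c != 0.
  rewrite (eigen_neq0 (eigen_character C c)) characterE big1 ?oner_eq0 // => z _.
  by rewrite ffunE muln0.
rewrite (perm_all _ perm_s); apply/allP/forall_inP => mono h.
  by move=> hv; apply: mono; rewrite mem_enum.
by rewrite mem_enum => /mono.
Qed.

Lemma dim_VCH0 : \dim (VCH C Gamma o 2 0) =
  #|[set c : monomial Gamma 2 alpha0 | [forall v, exists h in half_edges_at v,
      c (circle_of Gamma alpha0 (inl h, false))
        != c (circle_of Gamma alpha0 (inl h, true))]]|.
Proof.
apply: (dim_lker_diag (e := fun c => chain0 (character C c))).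
- move=> w; exists (fun c => #|monomial Gamma 2 alpha0|%:R^-1
    * dot (component w empty_state) (character C c)).
  rewrite -[LHS]chain0_component {1}(character_span (component w empty_state)).
  by rewrite linear_sum; apply: eq_bigr => c _; rewrite linearZ.
- move=> a a0; apply: (@character_free C G Gamma alpha0).
  rewrite -[LHS]component_chain0 linear_sum /=.
  under eq_bigr => c _ do rewrite linearZ.
  by rewrite /= a0; apply/ffunP=> k; rewrite !ffunE.
- move=> c /forallP good; apply/ffunP=> -[nu' k].
  have /cards1P[v def_nu'] : #|val nu'| == 1%N := valP nu'.
  rewrite (delta0E _ _ def_nu') ffunE.
  have [_] := delta_at_character v c.
  have /exists_inP[h hv ch] := good v.
  have /negPf-> : ~~ [forall h in half_edges_at v,
      c (circle_of Gamma alpha0 (inl h, false))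
        == c (circle_of Gamma alpha0 (inl h, true))].
    by apply/negP=> /forall_inP/(_ h hv); rewrite (negPf ch).
  move/negbFE/eqP; move: k; rewrite def_nu' => k ->; exact: ffunE.
move=> a a0 d /forallPn[v]; rewrite negb_exists_in => mono.
pose nu' : cube G 1 :=
  exist (fun nu : {set vertex G} => #|nu| == 1)%N [set v] (introT eqP (cards1 v)).
have sum0 : \sum_c a c *: delta_at [set v] v (character C c) = 0.
  apply/ffunP=> k; rewrite ffunE; transitivity (delta C Gamma o 2 0
    (\sum_c a c *: chain0 (character C c))
    (Tagged (fun nu : cube G 1 => monomial Gamma 2 (alpha_of (val nu)))
       (k : monomial Gamma 2 (alpha_of (val nu'))))); last first.
    by rewrite a0 ffunE.
  rewrite -[X in delta _ _ _ _ _ X](_ : chain0 (\sum_c a c *: character C c) = _).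
    rewrite (delta0E _ _ (erefl : val nu' = [set v])) linear_sum.
    by congr (fun_of_fin _ _); apply: eq_bigr => c _; rewrite linearZ.
  by rewrite linear_sum; apply: eq_bigr => c _; rewrite linearZ.
have [dw nz] := delta_at_character v d.
have {nz} : delta_at [set v] v (character C d) != 0.
  rewrite nz; apply/forall_inP => h hv; apply/negbNE.
  by apply: (forall_inP mono).
(* Pairing with the image of [d] isolates [a d]: images of other characters are eigenvectors for
   other colors, hence orthogonal to it. *)
move/(eigen_dot_neq0 dw) => dot_d; apply: (mulIf dot_d); rewrite mul0r.
transitivity (dot (\sum_c a c *: delta_at [set v] v (character C c))
                  (delta_at [set v] v (character C d))); last first.
  by rewrite sum0 /dot big1 // => k _; rewrite ffunE mul0r.
rewrite dot_suml (bigD1 d) //= big1 ?addr0 // => c ne.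
have [f cd] := circle_of_neq ne.
by rewrite (eigen_orthogonal (proj1 (delta_at_character v c)) dw cd) mulr0.
Qed.

End DegreeZero.

(** * Face colorings and perfect matchings *)

Section Connected.
Variable G : multigraph.

(** A loop in [M] would put two half-edges at its vertex, so counting half-edges already excludes
    loops; for other edges, half-edges at v correspond to incident edges. *)
Lemma perfect_matchingE (M : {set edge G}) : perfect_matching M =
  [forall v, #|[set h in half_edges_at v | h.1 \in M]| == 1%N].
Proof.
pose at_v (v : vertex G) := [set h in half_edges_at v | h.1 \in M].
have no_loop : perfect_matching M || [forall v, #|at_v v| == 1%N] ->
    forall e, e \in M -> ~~ is_loop e.
  case/orP=> [/andP[/forall_inP//]|/forallP one e eM].
  apply/negP=> /eqP loop; have /cards1P[h at_h] := one (endpoint e true).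
  have : (e, false) = (e, true).
    have : (e, false) \in at_v (endpoint e true).
      by rewrite !inE /vertex_of /= loop eqxx.
    have : (e, true) \in at_v (endpoint e true) by rewrite !inE /vertex_of /= eqxx.
    by rewrite at_h !inE => /eqP-> /eqP.
  by case.
suff card_at : (forall e, e \in M -> ~~ is_loop e) ->
    forall v, #|at_v v| = #|[set e in M | incident v e]|.
  apply/idP/forallP => [PM v|one].
    by rewrite card_at; [case/andP: PM => _ /forallP | apply: no_loop; rewrite PM].
  have nl : forall e, e \in M -> ~~ is_loop e.
    by apply: no_loop; apply/orP; right; apply/forallP.
  apply/andP; split; first exact/forall_inP.
  by apply/forallP=> v; rewrite -card_at //; apply: one.
move=> nl v; have -> : [set e in M | incident v e] = [set h.1 | h in at_v v].
  apply/setP=> e; rewrite inE; apply/andP/imsetP => [[eM /existsP[b vb]]|[h]].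
    by exists (e, b); rewrite // !inE /vertex_of /= vb eM.
  rewrite !inE => /andP[hv hM] ->; split=> //.
  by apply/existsP; exists h.2.
rewrite card_in_imset // => -[e b] [e' b']; rewrite !inE /vertex_of /=.
move=> /andP[/eqP ve eM] /andP[/eqP ve' _] eq_e; move: ve ve'; rewrite -eq_e.
have := nl e eM; rewrite /is_loop.
by case: b b' => [] [] // ne e1 e2; rewrite e1 e2 eqxx in ne.
Qed.

Lemma adjacent_sym : symmetric (@adjacent G).
Proof.
by case=> [u|z] [v|z'] //=; apply: eq_existsb => e; rewrite andbC.
Qed.

Lemma adjacent_connect x y : connected_graph G -> connect (@adjacent G) x y.
Proof.
have adj_sym := sym_connect_sym adjacent_sym.
case/mem_card1=> r roots_r.
have root_r z : fingraph.root (@adjacent G) z = r.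
  by apply/eqP; rewrite -[_ == _]/(_ \in pred1 r) -roots_r !inE roots_root.
by rewrite -(root_connect adj_sym) !root_r.
Qed.
End Connected.

(** * Mod 2 cellular homology of the sphere and two-colorings of its faces *)

Section PlaneColorings.
Variables (G : multigraph) (Gamma : ribbon_graph G) (alpha : {set half_edge G}).
Hypotheses (G_neq0 : (0 < #|vertex G|)%N) (G3 : trivalent G).
Hypotheses (G_conn : connected_graph G).
Hypothesis euler : (#|vertex G| + #|circle Gamma alpha| = #|edge G| + 2)%N.
Local Notation coloring := {ffun circle Gamma alpha -> ('F_2)^o}.
Local Notation "x @c f" := (x (circle_of Gamma alpha f)) (at level 10).
Implicit Types (x : coloring) (h : half_edge G) (v : vertex G).

Lemma addff (a : 'F_2) : a + a = 0.
Proof. exact/addrr_pchar2/pchar_Fp. Qed.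

Lemma oppff (a : 'F_2) : - a = a.
Proof. exact/oppr_pchar2/pchar_Fp. Qed.

Lemma F2_neq0 (a : 'F_2) : a = (a != 0)%:R.
Proof. by apply/val_inj; case: a => [[|[|]]]. Qed.

Lemma F2_natr_eq0 n : (n%:R == 0 :> 'F_2) = ~~ odd n.
Proof. by rewrite -(dvdn_pcharf (pchar_Fp (isT : prime 2))) dvdn2. Qed.

Lemma half_edges_at_neq0 v : exists h, vertex_of h = v.
Proof.
have /card_gt0P[h] : (0 < #|half_edges_at v|)%N by rewrite G3.
by rewrite inE => /eqP; exists h.
Qed.

(** The mod 2 boundary map from faces to edges; a face on both sides of an edge cancels. *)
Definition side_sum x : {ffun edge G -> ('F_2)^o} :=
  [ffun e => x @c (inl (e, false), false) + x @c (inl (e, false), true)].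

(** The mod 2 boundary map from edges to vertices; a loop is counted twice, hence vanishes. *)
Definition vertex_sum (y : {ffun edge G -> ('F_2)^o}) :
    {ffun vertex G -> ('F_2)^o} :=
  [ffun v => \sum_(h in half_edges_at v) y h.1].

Fact side_sum_linear : linear side_sum.
Proof.
move=> a x y; apply/ffunP=> e; rewrite !ffunE /= scalerDr addrACA.
reflexivity.
Qed.
HB.instance Definition _ := GRing.isLinear.Build _ _ _ *:%R side_sum side_sum_linear.

Fact vertex_sum_linear : linear vertex_sum.
Proof.
move=> a x y; apply/ffunP=> v; rewrite !ffunE /= scaler_sumr -big_split.
by apply: eq_bigr => h _; rewrite !ffunE.
Qed.
HB.instance Definition _ :=
  GRing.isLinear.Build _ _ _ *:%R vertex_sum vertex_sum_linear.

Lemma side_sumE x h : side_sum x h.1 = x @c (inl h, false) + x @c (inl h, true).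
Proof.
rewrite ffunE; case: h => e [] //=.
rewrite -(circle_of_side Gamma alpha (inl (e, true), false)).
rewrite -(circle_of_side Gamma alpha (inl (e, true), true)) /= /opposite /=.
by case: (half_twisted _ _ _) => //=; rewrite addrC.
Qed.

Lemma side_sum_eq0 x h :
  (side_sum x h.1 == 0) = (x @c (inl h, false) == x @c (inl h, true)).
Proof.
by rewrite side_sumE addr_eq0 (_ : - _ = x @c (inl h, true)) //; apply: oppff.
Qed.

Lemma vertex_of_rotation h : vertex_of (rotation Gamma h) = vertex_of h.
Proof. by apply/eqP; rewrite -(rotationP Gamma) (mem_porbit _ 1). Qed.

(** Each corner at v is seen from two flags, [(h, true)] and [(rotation h, false)], which lie on the
    same circle. *)
Lemma vertex_sum_side_sum x : vertex_sum (side_sum x) = 0.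
Proof.
apply/ffunP=> v; rewrite !ffunE.
under eq_bigr => h _ do rewrite side_sumE.
rewrite big_split /= (reindex_inj (perm_inj (s := rotation Gamma))) /=.
have -> : \sum_(h | rotation Gamma h \in half_edges_at v)
    x @c (inl (rotation Gamma h), false) =
  \sum_(h in half_edges_at v) x @c (inl h, true).
  apply: eq_big => [h|h _]; first by rewrite !inE vertex_of_rotation.
  by rewrite -(circle_of_corner Gamma alpha (inl h, true)).
exact: addff.
Qed.

(** Connectedness as an induction principle: [rotation] reaches all half-edges at a vertex and
    [opposite] crosses an edge. *)
Lemma half_edge_ind (P : half_edge G -> Prop) :
  (forall h, P h -> P (rotation Gamma h)) -> (forall h, P h -> P (opposite h)) ->
  forall h h', P h -> P h'.
Proof.
move=> Prot Popp h h' Ph.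
have Pvertex h1 h2 : vertex_of h2 = vertex_of h1 -> P h1 -> P h2.
  move=> /eqP; rewrite -(rotationP Gamma) => /porbitP[i ->] Ph1.
  by elim: i => [|i IHi]; rewrite ?perm1 // expgSr permM; apply: Prot.
pose Q (w : vertex G + circle_edge G) :=
  if w is inl v then forall h, vertex_of h = v -> P h else True.
suff : Q (inl (vertex_of h')) by apply.
have /connectP[p] :=
  adjacent_connect (inl (vertex_of h)) (inl (vertex_of h')) G_conn.
have : Q (inl (vertex_of h)) by move=> h1 h1v; apply: Pvertex Ph.
elim: p (inl (vertex_of h) : vertex G + circle_edge G) => [|w p IHp] u Qu.
  by move=> _ eq_u; rewrite (eq_u : _ = u).
rewrite [path _ _ _]/= => /andP[uw]; apply: IHp; case: u w uw Qu => [u|//] [w|//].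
case/existsP=> e /andP[/existsP[b /eqP bu] /existsP[b' /eqP bw]] Qu h1 h1w.
apply: (Pvertex (e, b')); first by rewrite h1w -bw.
have {}Qu := Qu (e, b) bu; have [-> //|nb] := eqVneq b' b.
suff -> : (e, b') = opposite (e, b) by apply: Popp.
by rewrite /opposite /=; case: b b' nb {bu bw Qu} => [] [].
Qed.

Lemma no_circle_edge (z : circle_edge G) : False.
Proof.
have /card_gt0P[v _] := G_neq0.
have /connectP[[|w p]] := adjacent_connect (inr z) (inl v) G_conn => //.
Qed.

Lemma side_sum_ker x : side_sum x = 0 -> forall f g, x @c f = x @c g.
Proof.
move=> x0 f g.
have same h : x @c (inl h, false) = x @c (inl h, true).
  by apply/eqP; rewrite -side_sum_eq0 x0 ffunE.
have same_b h b : x @c (inl h, b) = x @c (inl h, true) by case: b.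
case: f g => [[h|z] b]; last by case: (no_circle_edge z).
case=> [[h'|z] b']; last by case: (no_circle_edge z).
rewrite !same_b; apply: (@half_edge_ind
  (fun h1 => x @c (inl h, true) = x @c (inl h1, true)) _ _ h h') => // h1 ->.
  by rewrite -(circle_of_corner Gamma alpha (inl h1, true)) /= same.
by rewrite -(circle_of_side Gamma alpha (inl h1, true)) /= same_b.
Qed.

(** Crossing an edge changes the point mass at a vertex by the boundary of that edge, so by
    connectedness the image of [vertex_sum] has codimension at most 1. *)
Lemma vertex_sum_delta v0 v :
  [ffun w => (w == v)%:R : ('F_2)^o] \in
    (limg (linfun vertex_sum) + <[[ffun w => (w == v0)%:R : ('F_2)^o]]>)%VS.
Proof.
pose d v : {ffun vertex G -> ('F_2)^o} := [ffun w => (w == v)%:R].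
have [[h <-] [h0 <-]] := (half_edges_at_neq0 v, half_edges_at_neq0 v0).
apply: (@half_edge_ind
  (fun h1 =>
     d (vertex_of h1) \in (limg (linfun vertex_sum) + <[d (vertex_of h0)]>)%VS)
  _ _ h0 h) => [h1|h1|].
- by rewrite vertex_of_rotation.
- move=> d1; have -> : d (vertex_of (opposite h1)) =
      vertex_sum [ffun e => (e == h1.1)%:R] + d (vertex_of h1).
    apply/ffunP=> w; rewrite !ffunE big_mkcond (bigD1 h1) //=.
    rewrite (bigD1 (opposite h1)) /=; last first.
      by case: (h1) => e []; rewrite xpair_eqE andbF.
    rewrite !inE !ffunE eqxx (eq_sym w) (eq_sym w) big1 ?addr0.
      by case: eqP; case: eqP => //= _ _; rewrite ?addr0 ?add0r ?addff //
        ?[1 + 1]addff ?addrA ?addff ?add0r.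
    move=> h' /andP[n1 n2]; rewrite ffunE; case: ifP => // _.
    case: eqP => // e1; move: n1 n2; rewrite /opposite.
    case: h1 h' e1 {d1} => [e b] [e' b'] /= ->.
    by rewrite !xpair_eqE eqxx; case: b b' => [] [].
  by rewrite memvD // -lfunE (subvP (addvSl _ _)) ?memv_img ?memvf.
exact: (subvP (addvSr _ _)) _ (memv_line _).
Qed.

(* H_1 of the sphere vanishes mod 2: by connectedness the two boundary maps    *)
(* have ranks #faces - 1 and at least #vertices - 1, and Euler's formula gives *)
(* the equality of image and kernel.                                           *)
Lemma vertex_sum_exact y : vertex_sum y = 0 -> exists x, side_sum x = y.
Proof.
pose D1 := linfun vertex_sum; pose D2 := linfun side_sum => y0.
have dim_ffun (T : finType) : \dim {: {ffun T -> ('F_2)^o}} = #|T|.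
  by rewrite dimvf /dim /= muln1.
have /card_gt0P[v0 _] := G_neq0.
have rank1 : (#|vertex G| <= \dim (limg D1) + 1)%N.
  rewrite -dim_ffun; set d := [ffun w => (w == v0)%:R : ('F_2)^o].
  apply: leq_trans (_ : \dim (limg D1 + <[d]>) <= _)%N; last first.
    apply: leq_trans (leq_of_leqif (dimv_add_leqif _ _)) _.
    by rewrite leq_add2l dim_vline leq_b1.
  apply/dimvS/subvP=> u _.
  have -> : u = \sum_v u v *: [ffun w => (w == v)%:R : ('F_2)^o].
    apply/ffunP=> w; rewrite sum_ffunE (bigD1 w) //= big1 ?addr0 => [|v ne].
      by rewrite !ffunE eqxx [_ *: _]mulr1.
    by rewrite !ffunE eq_sym (negPf ne) [_ *: _]mulr0.
  by apply: memv_suml => v _; apply/memvZ/vertex_sum_delta.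
have ker2 : (\dim (lker D2) <= 1)%N.
  pose one : coloring := [ffun=> 1].
  apply: (@leq_trans (\dim <[one]>)); last first.
    by rewrite dim_vline leq_b1.
  apply/dimvS/subvP=> x; rewrite memv_ker lfunE => /eqP x0.
  have [h0 _] := half_edges_at_neq0 v0.
  apply/vlineP; exists (x @c (inl h0, true)); apply/ffunP=> z.
  have [f ->] := circle_of_surj z; rewrite !ffunE [_ *: _]mulr1.
  exact: side_sum_ker.
have sub : (limg D2 <= lker D1)%VS.
  apply/subvP=> _ /memv_imgP[x _ ->].
  by rewrite memv_ker !lfunE /= vertex_sum_side_sum.
have eq_im : limg D2 = lker D1.
  apply/eqP; rewrite eqEdim sub /=.
  have := limg_ker_dim D1 fullv; have := limg_ker_dim D2 fullv.
  rewrite !capfv !dim_ffun => e2 e1.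
  (* With rank-nullity for both maps, Euler's formula reduces the claim to [rank1] and [ker2], whose
     two error terms 1 add up to the Euler characteristic 2. *)
  rewrite -(leq_add2r (\dim (limg D1) + 2)) addnA e1 -euler -e2 addnA addnC.
  by rewrite leq_add2l (leq_trans (leq_add rank1 ker2)) // -addnA.
have : y \in limg D2 by rewrite eq_im memv_ker lfunE /= y0.
by case/memv_imgP=> x _ ->; exists x; rewrite lfunE.
Qed.

Definition same_sides x := [set e | side_sum x e == 0].

(** The number of bands at v separating the colors is even, as [side_sum x] is a cycle, and at most
    3. So it is 0 or 2, and exactly one band is left over when it is nonzero. *)
Lemma perfect_matching_same_sides x : perfect_matching (same_sides x) =
  [forall v, exists h in half_edges_at v,
     x @c (inl h, false) != x @c (inl h, true)].
Proof.
rewrite perfect_matchingE; apply: eq_forallb => v.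
pose D := [set h in half_edges_at v | side_sum x h.1 != 0].
have card_D : (#|[set h in half_edges_at v | h.1 \in same_sides x]| + #|D| = 3)%N.
  rewrite -(G3 v) -(cardsID [set h | h.1 \in same_sides x] (half_edges_at v)).
  by congr (_ + _)%N; apply: eq_card => h; rewrite !inE // andbC.
have evenD : ~~ odd #|D|.
  rewrite -F2_natr_eq0 -sum1_card natr_sum.
  have /ffunP/(_ v) := vertex_sum_side_sum x; rewrite !ffunE => {2}<-.
  rewrite [X in X == _]big_mkcond [X in _ == X]big_mkcond; apply/eqP.
  apply: eq_bigr => h _; rewrite !inE; case: eqP => //= _.
  by rewrite [RHS](F2_neq0 (side_sum x h.1)); case: eqP.
have -> : [exists h in half_edges_at v,
    x @c (inl h, false) != x @c (inl h, true)] = (0 < #|D|)%N.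
  apply/exists_inP/card_gt0P => -[h]; last first.
    by rewrite inE side_sum_eq0 => /andP[hv ch]; exists h.
  by move=> hv ch; exists h; rewrite inE hv side_sum_eq0.
by move: #|_| #|D| card_D evenD => [|[|[|[|a]]]] [|[|[|[|d]]]].
Qed.

(** The complement of [M] has degree 3 - 1 = 2 at each vertex, hence is a cycle and so a boundary;
    two solutions differ by a constant, by [side_sum_ker]. *)
Lemma card_same_sides (M : {set edge G}) : perfect_matching M ->
  #|[set x : coloring | same_sides x == M]| = 2%N.
Proof.
rewrite perfect_matchingE => /forallP PM.
pose y : {ffun edge G -> ('F_2)^o} := [ffun e => (e \notin M)%:R].
have [x0 x0y] : exists x, side_sum x = y.
  apply: vertex_sum_exact; apply/ffunP=> v; rewrite !ffunE.
  transitivity (#|half_edges_at v :\: [set h | h.1 \in M]|%:R : 'F_2).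
    rewrite -sum1_card natr_sum [LHS]big_mkcond [RHS]big_mkcond.
    by apply: eq_bigr => h _; rewrite !inE ffunE andbC; case: ifP; case: (_ \in M).
  have := cardsID [set h | h.1 \in M] (half_edges_at v); rewrite G3.
  have -> : half_edges_at v :&: [set h | h.1 \in M] =
      [set h in half_edges_at v | h.1 \in M] by apply/setP=> h; rewrite !inE.
  by rewrite (eqP (PM v)) add1n => -[->]; apply/eqP; rewrite F2_natr_eq0.
have same_sidesE x : (same_sides x == M) = (side_sum x == y).
  apply/eqP/eqP => [xM|xy].
    by apply/ffunP=> e; rewrite [RHS]ffunE -xM inE; apply: F2_neq0.
  by apply/setP=> e; rewrite inE xy ffunE; case: (_ \in M).
(* A half-edge, and with it a circle, exists, so that [x0] and its complement are distinct. *)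
have [v _] : exists v : vertex G, true by have /card_gt0P[v] := G_neq0; exists v.
have [h _] := half_edges_at_neq0 v.
suff -> : [set x | same_sides x == M] = [set x0; x0 + [ffun=> 1]].
  rewrite cards2; suff -> : x0 != x0 + [ffun=> 1] by [].
  rewrite -[X in X != _]addr0 (inj_eq (addrI _)); apply/eqP.
  by move/ffunP/(_ (circle_of Gamma alpha (inl h, true))); rewrite !ffunE.
apply/setP=> x; rewrite !inE same_sidesE -x0y; apply/idP/orP => [/eqP xx0|].
  have const := side_sum_ker (x := x - x0).
  have {}const f : (x - x0) @c f = (x - x0) @c (inl h, true).
    by apply: const; rewrite linearB /= xx0 subrr.
  have x_eq : x = x0 + [ffun=> (x - x0) @c (inl h, true)].
    apply/ffunP=> z; have [f ->] := circle_of_surj z.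
    by rewrite ffunE [X in _ + X]ffunE -(const f) !ffunE addrC subrK.
  have [a0|a1] : (x - x0) @c (inl h, true) = 0 \/ (x - x0) @c (inl h, true) = 1.
  - by rewrite (F2_neq0 (_ @c _)); case: (_ @c _ == _); [left|right].
  - left; rewrite x_eq a0; apply/eqP/ffunP=> z; rewrite !ffunE; exact: addr0.
  by right; rewrite {1}x_eq a1.
case=> /eqP-> //; rewrite linearD /= -subr_eq0 addrAC subrr add0r.
by apply/eqP/ffunP=> e; rewrite !ffunE addff.
Qed.

Lemma card_two_colorings :
  #|[set x : coloring | [forall v, exists h in half_edges_at v,
       x @c (inl h, false) != x @c (inl h, true)]]| =
  (2 * #|[set M : {set edge G} | perfect_matching M]|)%N.
Proof.
rewrite -sum1_card (partition_big same_sides (@perfect_matching G)) /=; last first.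
  by move=> x; rewrite inE perfect_matching_same_sides.
rewrite mulnC -[#|_|]sum1dep_card big_distrl /=; apply: eq_bigr => M PM.
rewrite mul1n; apply: etrans (card_same_sides PM).
rewrite -sum1dep_card; apply: eq_bigl => x.
rewrite inE -perfect_matching_same_sides.
by case: eqP => [->|_]; rewrite ?PM ?andbF.
Qed.

End PlaneColorings.

Theorem theoremB (R : realType) (G : multigraph) (Gamma : ribbon_graph G)
    (o : conventions G) :
  (0 < #|vertex G|)%N ->
  trivalent G ->
  connected_graph G ->
  plane_graph Gamma ->
  \dim (VCH R[i] Gamma o 2 0) =
    (2 * #|[set M : {set edge G} | perfect_matching M]|)%N.
Proof.
move=> V_gt0 G3 G_conn [_ euler]; rewrite dim_VCH0 //.
suff euler0 : (#|vertex G| + #|circle Gamma (alpha_of set0)| = #|edge G| + 2)%N.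
  (* The exponents in ['I_2] and the colors in ['F_2] are convertible, so both counts concern the
     same functions. *)
  exact: card_two_colorings V_gt0 G3 G_conn euler0.
have -> : @alpha_of G set0 = set0 by apply/setP=> h; rewrite !inE.
apply/eqP; rewrite -eqz_nat !PoszD; move/eqP: euler.
by rewrite /closed_euler_char addrAC subr_eq [X in _ == X -> _]addrC.
Qed.
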